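(* Let $\beta\in(1,\beta_*]$, where $\beta_*\approx1.4656$ is the real root of $x^3-x^2-1=0$. Then the dynamical systems $(\Omega\times\Upsilon\times S_\beta,\mathcal A\times\mathcal B\times\mathcal S,\nu_\beta,K_\beta)$ and $(\Upsilon,\mathcal B,\mathbb P,\sigma')$ are isomorphic, where $\nu_\beta(A)=\mathbb P(\varphi(Z\cap A))$ for $A\in\mathcal A\times\mathcal B\times\mathcal S$.
   Context: $\vec q_0=(0,0)$, $\vec q_1=(1,0)$, $\vec q_2=(0,1)$; $S_\beta$ is the attractor of the IFS $f_{\vec q_i}(\vec z)=(\vec z+\vec q_i)/\beta$ (here the closed triangle with vertices $(0,0)$, $(\frac1{\beta-1},0)$, $(0,\frac1{\beta-1})$), $\mathcal S$ its Borel $\sigma$-algebra. Subsets of $S_\beta$: $E_0=[0,\frac1\beta)\times[0,\frac1\beta)$; $E_1=\{0\le y<\frac1\beta,\ \frac{1}{\beta(\beta-1)}<x+y\le\frac{1}{\beta-1}\}$; $E_2=\{0\le x<\frac1\beta,\ \frac{1}{\beta(\beta-1)}<x+y\le\frac{1}{\beta-1}\}$; $C_{01}=\{x\ge\frac1\beta,\ 0\le y<\frac1\beta,\ x+y\le\frac{1}{\beta(\beta-1)}\}$; $C_{12}=\{x\ge\frac1\beta,\ y\ge\frac1\beta,\ \frac{1}{\beta(\beta-1)}<x+y\le\frac{1}{\beta-1}\}$; $C_{02}=\{0\le x<\frac1\beta,\ y\ge\frac1\beta,\ x+y\le\frac{1}{\beta(\beta-1)}\}$; $C_{012}=\{x\ge\frac1\beta,\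 y\ge\frac1\beta,\ x+y\le\frac{1}{\beta(\beta-1)}\}$; $C=C_{01}\cup C_{12}\cup C_{02}$. $\Omega=\{0,1\}^{\mathbb N}$, $\Upsilon=\{0,1,2\}^{\mathbb N}$ with product $\sigma$-algebras $\mathcal A,\mathcal B$ and left shifts $\sigma,\sigma'$; $\mathbb P$ is the uniform product measure on $\Upsilon$. $K_\beta$ on $\Omega\times\Upsilon\times S_\beta$: $K_\beta(\omega,\upsilon,\vec z)=(\omega,\upsilon,\beta\vec z-\vec q_i)$ if $\vec z\in E_i$; $(\sigma\omega,\upsilon,\beta\vec z-\vec q_i)$ if $\omega_1=0$, $\vec z\in C_{ij}$ ($ij\in\{01,12,02\}$); $(\sigma\omega,\upsilon,\beta\vec z-\vec q_j)$ if $\omega_1=1$, $\vec z\in C_{ij}$; $(\omega,\sigma'\upsilon,\beta\vec z-\vec q_i)$ if $\vec z\in C_{012}$, $\upsilon_1=i$. The digit $d_1(\omega,\upsilon,\vec z)$ is the vector subtracted, $d_n=d_1\circ K_\beta^{n-1}$. $\varphi:\Omega\times\Upsilon\times S_\beta\to\Upsilon$, $\varphi(\omega,\upsilon,\vec z)=(b_1,b_2,\ldots)$ with $d_n(\omega,\upsilon,\vec z)=\vec q_{b_n}$. $Z$ is the set of points whose $K_\beta$-orbit lies in $\Omega\times\Upsilon\times C$ for infinitely many times and in $\Omega\times\Upsilon\times C_{012}$ for infinitely many times. *)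

(* Defs.v *)
From HB Require Import structures.
From mathcomp Require Import all_boot all_order all_algebra.
From mathcomp Require Import all_classical all_reals all_analysis.

Set Implicit Arguments.
Unset Strict Implicit.
Unset Printing Implicit Defensive.

Import Order.TTheory GRing.Theory Num.Theory.
Local Open Scope classical_set_scope.
Local Open Scope ring_scope.

(* Sequences are indexed from 0: the paper's omega_1 is [w 0].          *)

Definition cyl {T : Type} (n : nat) (a : nat -> T) : set (nat -> T) :=
  [set w | forall k, (k < n)%N -> w k = a k].

Definition cylinders (T : Type) : set (set (nat -> T)) :=
  [set C | exists n a, C = @cyl T n a].

(* 'I_3 = {0,1,2} made a pointed type (needed for the sigma-algebra instance) *)
HB.instance Definition _ := isPointed.Build 'I_3 (@Ordinal 3 0 isT).

(* Omega = {0,1}^N (bool: false = 0, true = 1), Upsilon = {0,1,2}^N *)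
Notation Omega := (g_sigma_algebraType (@cylinders bool)).
Notation Ups := (g_sigma_algebraType (@cylinders 'I_3)).

Definition seq_shift {T : Type} (w : nat -> T) : nat -> T := fun n => w n.+1.

(* The state space: Omega x Upsilon x R^2 (with the product sigma-algebra,
   R carrying its Borel sigma-algebra); the dynamics lives on
   Omega x Upsilon x S_beta, see [Xb] below. *)
Definition X (R : realType) := (Omega * Ups * (R * R))%type.

Section Kbeta.
Variables (R : realType) (b : R).

Definition Sb : set (R * R) :=
  [set z | 0 <= z.1 /\ 0 <= z.2 /\ z.1 + z.2 <= (b - 1)^-1].

Let t := b^-1.
Let s := (b * (b - 1))^-1.

Definition E0 : set (R * R) :=
  [set z | 0 <= z.1 < t /\ 0 <= z.2 < t].
Definition E1 : set (R * R) :=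
  [set z | 0 <= z.2 < t /\ s < z.1 + z.2 <= (b - 1)^-1].
Definition E2 : set (R * R) :=
  [set z | 0 <= z.1 < t /\ s < z.1 + z.2 <= (b - 1)^-1].
Definition C01 : set (R * R) :=
  [set z | t <= z.1 /\ 0 <= z.2 < t /\ z.1 + z.2 <= s].
Definition C12 : set (R * R) :=
  [set z | t <= z.1 /\ t <= z.2 /\ s < z.1 + z.2 <= (b - 1)^-1].
Definition C02 : set (R * R) :=
  [set z | 0 <= z.1 < t /\ t <= z.2 /\ z.1 + z.2 <= s].
Definition C012 : set (R * R) :=
  [set z | t <= z.1 /\ t <= z.2 /\ z.1 + z.2 <= s].
Definition Cs : set (R * R) := C01 `|` C12 `|` C02.

Definition i0 : 'I_3 := @Ordinal 3 0 isT.
Definition i1 : 'I_3 := @Ordinal 3 1 isT.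
Definition i2 : 'I_3 := @Ordinal 3 2 isT.

Definition q (i : 'I_3) : R * R :=
  if val i == 1%N then (1, 0) else if val i == 2%N then (0, 1) else (0, 0).

Definition aff (i : 'I_3) (z : R * R) : R * R :=
  (b * z.1 - (q i).1, b * z.2 - (q i).2).

(* one step: (index of the digit subtracted, image under K_beta).
   Outside Omega x Upsilon x S_beta (irrelevant) the point is left fixed. *)
Definition Kstep (x : X R) : 'I_3 * X R :=
  let: (w, u, z) := x in
  if z \in E0 then (i0, (w, u, aff i0 z))
  else if z \in E1 then (i1, (w, u, aff i1 z))
  else if z \in E2 then (i2, (w, u, aff i2 z))
  else if z \in C01 then
    let i := if w 0%N then i1 else i0 in (i, (seq_shift w, u, aff i z))
  else if z \in C12 then
    let i := if w 0%N then i2 else i1 in (i, (seq_shift w, u, aff i z))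
  else if z \in C02 then
    let i := if w 0%N then i2 else i0 in (i, (seq_shift w, u, aff i z))
  else if z \in C012 then (u 0%N, (w, seq_shift u, aff (u 0%N) z))
  else (i0, x).

Definition Kb (x : X R) : X R := (Kstep x).2.

(* d_n = q_{b_n} with b_n the index returned at step n *)
Definition phi (x : X R) : Ups := fun n => (Kstep (iter n Kb x)).1.

Definition Xb : set (X R) := [set x | Sb x.2].

Definition Zb : set (X R) :=
  [set x | Xb x /\
     (forall N, exists2 n, (N <= n)%N & Cs (iter n Kb x).2) /\
     (forall N, exists2 n, (N <= n)%N & C012 (iter n Kb x).2)].

Definition nub (P : set Ups -> \bar R) (A : set (X R)) : \bar R :=
  P (phi @` (Zb `&` A)).

End Kbeta.

Definition is_probability_on {d} {T : measurableType d} {R : realType}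
  (D : set T) (mu : set T -> \bar R) : Prop :=
  [/\ mu set0 = 0%E, (forall A, measurable A -> (0 <= mu A)%E),
      semi_sigma_additive mu & mu D = 1%E].

Definition ds_isomorphic {d1 d2} {X1 : measurableType d1}
  {X2 : measurableType d2} {R : realType}
  (D1 : set X1) (mu1 : set X1 -> \bar R) (T1 : X1 -> X1)
  (D2 : set X2) (mu2 : set X2 -> \bar R) (T2 : X2 -> X2) : Prop :=
  exists (N : set X1) (M : set X2) (psi : X1 -> X2) (psi' : X2 -> X1),
    [/\ [/\ measurable N, N `<=` D1, mu1 (D1 `\` N) = 0%E & T1 @` N `<=` N],
        [/\ measurable M, M `<=` D2, mu2 (D2 `\` M) = 0%E & T2 @` M `<=` M],
        [/\ psi @` N `<=` M, psi' @` M `<=` N,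
            (forall x, N x -> psi' (psi x) = x) &
            (forall y, M y -> psi (psi' y) = y)],
        [/\ measurable_fun N psi, measurable_fun M psi' &
            (forall B, measurable B -> mu1 (N `&` psi @^-1` B) = mu2 (M `&` B))] &
        (forall x, N x -> psi (T1 x) = T2 (psi x))].

(* Main.v *)
(* Give the digit i of an expansion the total weight of its occurrences, the
   occurrence at place n weighing b^-n. Then Sb is described by three barycentric
   weights of sum 1/(b-1), and digit i may be subtracted exactly when its weight
   is at least 1/b. Every sequence u of digits is therefore the itinerary of its
   own point z = sum q_(u_n) b^-n, provided that the coin tosses of Omega and
   Upsilon are read off u at the successive visits of the orbit of z to C and to
   C012; this inverts phi as soon as both sets are visited infinitely often.
   Almost every u does so, because each of C and C012 contains the points of a
   whole cylinder; for C012 and b <= beta_* the word 01212222 defines one. *)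
Require Import Defs.
From HB Require Import structures.
From mathcomp Require Import all_boot all_order all_algebra.
From mathcomp Require Import all_classical all_reals all_analysis.
From mathcomp Require Import measurable_realfun.
From mathcomp Require Import ring lra.
Set Implicit Arguments.
Unset Strict Implicit.
Unset Printing Implicit Defensive.
Import Order.TTheory GRing.Theory Num.Theory numFieldNormedType.Exports.
Local Open Scope classical_set_scope.
Local Open Scope ring_scope.

(** * Measures on sequence spaces *)

Section sequences.
Variable T : pointedType.
Hypothesis cT : countable [set: T].

Local Notation seqT := (g_sigma_algebraType (@cylinders T)).

Lemma measurable_cyl n (a : nat -> T) : measurable (cyl n a : set seqT).
Proof. by apply: sub_sigma_algebra; exists n, a. Qed.

(** Cylinders fix an initial segment only, so the letters before place [k] have to be freed. This is
    done one at a time, as a union over the countably many values of each. *)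
Lemma measurable_coord (k : nat) (s : T) : measurable [set w : seqT | w k = s].
Proof.
have block m n (a : nat -> T) :
    measurable [set w : seqT | forall j, (j < n)%N -> w (m + j)%N = a j].
  elim: m n a => [|m IH] n a; first exact: measurable_cyl.
  rewrite (_ : mkset _ = \bigcup_(t : T) [set w : seqT |
      forall j, (j < n.+1)%N -> w (m + j)%N = if j is i.+1 then a i else t]).
    by apply: countable_bigcupT_measurable => // t; exact: IH.
  apply/seteqP; split => [w /= wa|w [t _] /= wa j jn].
    exists (w m) => // -[|j] jn; first by rewrite addn0.
    by rewrite addnS -addSn wa.
  by rewrite addSn -addnS wa.
have := block k 1 (fun=> s); rewrite (_ : mkset _ = [set w : seqT | w k = s])//.
apply/seteqP; split => [w /= /(_ 0 isT)|w /= wk [|//] _]; by rewrite addn0.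
Qed.

Lemma measurable_fun_seq d (U : measurableType d) (f : U -> seqT) :
  (forall k s, measurable [set x | f x k = s]) -> measurable_fun setT f.
Proof.
move=> mf; apply: (@measurability _ _ U seqT setT f (@cylinders T)); first by [].
move=> _ [_ [n [a ->]] <-]; rewrite setTI.
rewrite (_ : _ @^-1` _ = \bigcap_(k in `I_n) [set x | f x k = a k]).
  by apply: bigcap_measurableType.
by apply/seteqP; split => x /=.
Qed.

Lemma measurable_shift : measurable_fun setT (@seq_shift T : seqT -> seqT).
Proof. by apply: measurable_fun_seq => k s; exact: measurable_coord. Qed.

End sequences.

Lemma iter_shift (T : Type) n (w : nat -> T) k : iter n seq_shift w k = w (n + k)%N.
Proof. by elim: n k => // n IH k; rewrite iterS {1}/seq_shift IH addnS. Qed.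

Lemma measurable_iter_fun d (U : measurableType d) (f : U -> U) n :
  measurable_fun setT f -> measurable_fun setT (iter n f).
Proof. by move=> mf; elim: n => [|n IH]; [exact: measurable_id|exact: measurableT_comp]. Qed.

(** * Independence and recurrence under the uniform product measure *)

Section bernoulli.
Variables (R : realType) (P : probability Ups R).
Hypothesis hP : forall n (a : nat -> 'I_3), P (cyl n a) = ((3%:R : R) ^- n)%:E.

Let shift : Ups -> Ups := seq_shift.
Let mshift : measurable_fun setT shift.
Proof. by apply: measurable_shift; exact: countableP. Qed.

(** As functions of [V] both sides are finite measures, and they agree on cylinders; uniqueness on a
    generating pi-system does the rest. *)
Lemma measure_cyl1_shift (i : 'I_3) (V : set Ups) : measurable V ->
  (P (cyl 1 (fun=> i) `&` shift @^-1` V) = (3%:R^-1)%:E * P V)%E.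
Proof.
move=> mV; have mC : measurable (cyl 1 (fun=> i) : set Ups) by exact: measurable_cyl.
have r3 : 0 <= (3%:R^-1 : R) by rewrite invr_ge0.
(* Incompatible cylinders have empty intersection, so the empty set is adjoined to obtain a
   pi-system. *)
pose G : set (set Ups) := [set A | cylinders A \/ A = set0].
have mG : measurable = <<s G >>.
  apply/seteqP; split; apply: smallest_sub; try exact: smallest_sigma_algebra.
  - by move=> A cA; apply: sub_sigma_algebra; left.
  - by move=> A [cA|->]; [exact: sub_sigma_algebra|exact: measurable0].
have GI : setI_closed G.
  move=> A B [[n [a ->]]|->]; last by right; rewrite set0I.
  move=> [[m [c ->]]|->]; last by right; rewrite setI0.
  have [[w [wa wc]]|nw] := pselect (cyl n a `&` cyl m c !=set0).
    left; exists (maxn n m), w; apply/seteqP; split => [v [va vc] k|v vw].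
      by rewrite leq_max => /orP[kn|km]; [rewrite va ?wa|rewrite vc ?wc].
    by split=> k km; rewrite vw ?leq_max ?km ?orbT//; [exact: wa|exact: wc].
  by right; apply/seteqP; split => // x xx; apply: nw; exists x.
rewrite setIC.
pose m1 := [the {measure set Ups -> \bar R} of mrestr P mC].
have G0 : G setT by left; exists 0%N, (fun=> i); apply/seteqP; split.
apply: (measure_unique G (fun=> setT) mG GI _ _
  (pushforward m1 shift) (mscale (NngNum r3) P)) => //.
- by apply/seteqP; split => // x _; exists 0%N.
- move=> _ [[n [a ->]]|->]; last by rewrite !measure0.
  rewrite -[LHS]/(P (shift @^-1` cyl n a `&` cyl 1 (fun=> i))).
  rewrite -[RHS]/((3%:R^-1)%:E * P (cyl n a))%E.
  rewrite (_ : _ `&` _ = cyl n.+1 (fun k => if k is j.+1 then a j else i)).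
    by rewrite !hP exprS invfM EFinM.
  apply/seteqP; split => [w [wa wi] [_|k kn]|w wa].
  + exact: wi.
  + exact: wa.
  + by split=> [k kn|[|//] _]; [exact: (wa k.+1)|exact: (wa 0%N)].
- move=> _; rewrite (@le_lt_trans _ _ 1%E) ?ltry//.
  rewrite -[leLHS]/(P (shift @^-1` setT `&` cyl 1 (fun=> i))) preimage_setT setTI.
  exact: probability_le1.
Qed.

(** The three possible first letters cut the preimage into pieces of mass [P V / 3] each. *)
Lemma measure_shift (V : set Ups) : measurable V -> P (shift @^-1` V) = P V.
Proof.
move=> mV; have mC i : measurable (cyl 1 (fun=> i) : set Ups) by exact: measurable_cyl.
have mS : measurable (shift @^-1` V) by rewrite -[_ @^-1` _]setTI; exact: mshift.
have -> : shift @^-1` V = \big[setU/set0]_(i < 3) (cyl 1 (fun=> i) `&` shift @^-1` V).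
  rewrite -bigcup_mkord_ord; apply/seteqP; split => [w Vw|w [k _ []]//].
  exists (w 0%N); first exact: ltn_ord.
  by split => // -[|//] _; rewrite inord_val.
rewrite measure_bigsetU_ord//=; last first.
- apply/trivIsetP => i j _ _ ij; rewrite -subset0 => w [[wi _] [wj _]].
  by move/eqP: ij; apply; rewrite -(wi 0%N isT) (wj 0%N isT).
- by move=> i; exact: measurableI.
under eq_bigr do rewrite measure_cyl1_shift//.
rewrite !big_ord_recl big_ord0 adde0 -(fineK (fin_num_measure P _ mV)).
by rewrite -!EFinM -!EFinD; congr EFin; field.
Qed.

(** Independence of the first [n] letters from the tail, by splitting off one letter at a time. *)
Lemma measure_cyl_shift n (a : nat -> 'I_3) (V : set Ups) : measurable V ->
  (P (cyl n a `&` iter n shift @^-1` V) = (3%:R ^- n)%:E * P V)%E.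
Proof.
move=> mV; elim: n a => [|n IH] a.
  rewrite expr0 invr1 mul1e; congr (P _).
  by apply/seteqP; split => // w [].
rewrite (_ : _ `&` _ = cyl 1 (fun=> a 0%N) `&`
    shift @^-1` (cyl n (seq_shift a) `&` iter n shift @^-1` V)).
  rewrite measure_cyl1_shift; last first.
    apply: measurableI; first exact: measurable_cyl.
    by rewrite -[_ @^-1` _]setTI; apply: measurable_iter_fun.
  by rewrite IH muleA -EFinM -invfM -exprS.
apply/seteqP; split => w; rewrite /preimage /= -iterSr.
  move=> [wa wV]; split; first by case=> // _; exact: wa.
  by split => // k kn; exact: (wa k.+1).
by move=> [w0 [wa wV]]; split => // -[_|k kn]; [exact: w0|exact: wa].
Qed.

(* Let V be the set of u avoiding the word a at all multiples of L. Then
   V = s^-L V `\` cyl L a, and s^-L V is independent of cyl L a, so that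
   P V = P V - 3^-L * P V. *)
Lemma measure_io_cyl L (a : nat -> 'I_3) :
  P.-negligible (~` [set u | forall N,
    exists2 n, (N <= n)%N & cyl L a (iter n shift u)]).
Proof.
have mI n : measurable_fun setT (iter n shift) by exact: measurable_iter_fun.
have mpre n (A : set Ups) : measurable A -> measurable (iter n shift @^-1` A).
  by move=> mA; rewrite -[_ @^-1` _]setTI; exact: mI.
have mC : measurable (cyl L a : set Ups) by exact: measurable_cyl.
pose V := \bigcap_k ~` (iter (k * L) shift @^-1` cyl L a).
have mV : measurable V.
  apply: bigcap_measurableType => k _; apply: measurableC; exact: mpre.
have Pit n : P (iter n shift @^-1` V) = P V.
  elim: n => // n IH; rewrite -[RHS]IH -(measure_shift (mpre n _ mV)); congr (P _).
  by apply/seteqP; split => w; rewrite /preimage /= -iterSr.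
have VE : V = iter L shift @^-1` V `\` cyl L a.
  apply/seteqP; split => [w wV|w [wV wa] [|k] _].
  - split; last exact: (wV 0%N).
    by move=> k _; rewrite /preimage /= -iterD -mulSnr; exact: (wV k.+1).
  - exact: wa.
  - by rewrite /preimage /= mulSnr iterD; exact: (wV k).
have V0 : P V = 0%E.
  have : P (iter L shift @^-1` V) = (P V + P (cyl L a `&` iter L shift @^-1` V))%E.
    by rewrite (measureDI P (mpre L _ mV) mC) -VE setIC.
  rewrite Pit measure_cyl_shift//.
  rewrite -(fineK (fin_num_measure P _ mV)) -EFinM -EFinD => -[] /eqP.
  rewrite -subr_eq0 opprD addNKr oppr_eq0 mulf_eq0 => /orP[|/eqP ->//].
  by rewrite invr_eq0 expf_eq0 pnatr_eq0 andbF.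
(* If the word does not occur in [u] from place [N] on, the [N]-th shift of [u] avoids it at every
   multiple of [L] and so lies in [V]. *)
apply: negligibleS (_ : P.-negligible (\bigcup_N iter N shift @^-1` V)).
  move=> u /existsNP[N uN]; exists N => // k _ ua; apply: uN.
  by exists (k * L + N)%N; rewrite ?leq_addl// iterD.
apply: negligible_bigcup => N; apply/negligibleP; first exact: mpre.
exact: etrans (Pit N) V0.
Qed.

End bernoulli.

(** * Reading a sequence along the visits to a set *)

Section recording.
Variables (T : Type) (f : T -> T) (V Q : pred T).

Definition visits (x : T) (n : nat) : nat := (\sum_(j < n) V (iter j f x))%N.

(* The value of Q at the visit number k (from 0) of the orbit of x to V, and
   false if there are at most k visits. *)
Definition recorded (x : T) (k : nat) : bool :=
  `[< exists j, [/\ V (iter j f x), visits x j = k & Q (iter j f x)] >].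

Lemma visitsSr x n : visits x n.+1 = (visits x n + V (iter n f x))%N.
Proof. by rewrite /visits big_ord_recr. Qed.

Lemma visitsSl x n : visits x n.+1 = (V x + visits (f x) n)%N.
Proof.
by rewrite /visits big_ord_recl; under eq_bigr do rewrite /= -iterS iterSr.
Qed.

(** With the next two lemmas this gives a recursion: the record of [x] is that of [f x], preceded by
    [Q x] when [x] is in [V]. It mirrors how [Kb] consumes one entry of a coin sequence at each
    visit. *)
Lemma recorded_skip x k : ~~ V x -> recorded (f x) k = recorded x k.
Proof.
move=> /negbTE Vx; apply/asboolP/asboolP => [[j [Vj cj Qj]]|[[|j] [Vj cj Qj]]].
- by exists j.+1; rewrite visitsSl Vx iterSr.
- by rewrite /= Vx in Vj.
- by exists j; move: cj; rewrite visitsSl Vx; move: Vj Qj; rewrite iterSr.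
Qed.

Lemma recordedS x k : V x -> recorded x k.+1 = recorded (f x) k.
Proof.
move=> Vx; apply/asboolP/asboolP => [[[|j] [Vj cj Qj]]|[j [Vj cj Qj]]].
- by rewrite /visits big_ord0 in cj.
- by exists j; move: cj Vj Qj; rewrite visitsSl Vx iterSr => -[].
- by exists j.+1; rewrite visitsSl Vx iterSr cj.
Qed.

Lemma recorded0 x : V x -> recorded x 0 = Q x.
Proof.
move=> Vx; apply/asboolP/idP => [[[|j] [Vj cj Qj]]//|Qx].
  by move: cj; rewrite visitsSl Vx.
by exists 0%N; rewrite /visits big_ord0.
Qed.

(** The count is unbounded and grows by at most one per step, so the step at which it first exceeds
    [k] is a visit made at count [k]. *)
Lemma visit_with_count x k : (forall N, exists2 n, (N <= n)%N & V (iter n f x)) ->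
  exists2 j, V (iter j f x) & visits x j = k.
Proof.
move=> io; have [n] : exists n, (k < visits x n)%N.
  elim: k => [|k [n kn]].
    by have [n _ Vn] := io 0%N; exists n.+1; rewrite visitsSr Vn addn1.
  have [m nm Vm] := io n; exists m.+1; rewrite visitsSr Vm addn1 ltnS.
  apply: leq_trans kn _; rewrite /visits -(subnKC nm) big_split_ord /=.
  exact: leq_addr.
elim: n => [|n IH]; first by rewrite /visits big_ord0.
rewrite visitsSr; have [/IH//|nk] := ltnP k (visits x n).
case Vn : (V _); last by rewrite addn0 ltnNge nk.
by rewrite addn1 ltnS => kn; exists n => //; apply/eqP; rewrite eqn_leq nk.
Qed.

(** Used to recover the coin sequences of a point from its digits; infinitely many visits ensure
    that every entry of [w] is read. *)
Lemma recorded_id x (w : nat -> bool) :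
  (forall N, exists2 n, (N <= n)%N & V (iter n f x)) ->
  (forall j, V (iter j f x) -> Q (iter j f x) = w (visits x j)) ->
  forall k, recorded x k = w k.
Proof.
move=> io Qw k; have [j Vj jk] := visit_with_count k io.
apply/asboolP/idP => [[i [Vi <- Qi]]|wk]; first by rewrite -Qw.
by exists j; rewrite Qw// jk.
Qed.

End recording.

Section measurable_recording.
Context d (T : measurableType d) (f : T -> T) (V Q : pred T).
Hypotheses (mf : measurable_fun setT f).
Hypotheses (mV : measurable [set x | V x]) (mQ : measurable [set x | Q x]).

Let mpre n (A : set T) : measurable A -> measurable (iter n f @^-1` A).
Proof. by move=> mA; rewrite -[_ @^-1` _]setTI; exact: measurable_iter_fun. Qed.

Lemma measurable_visits n k : measurable [set x | visits f V x n = k].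
Proof.
elim: n k => [|n IH] k.
  have [->|k0] := eqVneq k 0%N.
    rewrite (_ : mkset _ = setT)//; apply/seteqP; split => // x _.
    by rewrite /= /visits big_ord0.
  rewrite (_ : mkset _ = set0)//; apply/seteqP; split => // x /=.
  by rewrite /visits big_ord0 => k0'; rewrite -k0' eqxx in k0.
rewrite (_ : mkset _ = (~` (iter n f @^-1` [set x | V x]) `&` [set x | visits f V x n = k])
    `|` ((iter n f @^-1` [set x | V x]) `&`
         if k is k'.+1 then [set x | visits f V x n = k'] else set0)).
  apply: measurableU; apply: measurableI => //.
  - by apply: measurableC; exact: mpre.
  - exact: mpre.
  - by case: k.
apply/seteqP; split => x /=; rewrite /preimage /= visitsSr.
- case: (V _) => [|<-]; last by left; rewrite addn0.
  by rewrite addn1 => <-; right.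
- by case=> -[Vx]; [move/negP/negbTE: Vx => ->|rewrite Vx; case: k => // k]; 
    move=> ->; rewrite ?addn0 ?addn1.
Qed.

Lemma measurable_recorded k : measurable [set x | recorded f V Q x k].
Proof.
rewrite (_ : mkset _ = \bigcup_j (iter j f @^-1` [set x | V x] `&`
    [set x | visits f V x j = k] `&` iter j f @^-1` [set x | Q x])).
  apply: bigcupT_measurable => j; apply: measurableI; last exact: mpre.
  by apply: measurableI; [exact: mpre|exact: measurable_visits].
apply/seteqP; split => [x /asboolP[j []]|x [j _ [[]]]]; first by exists j.
by move=> Vj cj Qj; apply/asboolP; exists j.
Qed.

End measurable_recording.

(** * Weights of digits *)

Section expansion.
Variables (R : realType) (b : R).
Hypothesis b1 : 1 < b.
Let t := b^-1.
Let c := (b - 1)^-1.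

Let b0 : 0 < b. Proof. exact: lt_trans b1. Qed.
Let t0 : 0 < t. Proof. by rewrite invr_gt0. Qed.
Let t1 : t < 1. Proof. by rewrite invf_lt1. Qed.
Let c0 : 0 < c. Proof. by rewrite invr_gt0 subr_gt0. Qed.
Let ct : c = t * (1 + c).
Proof. by rewrite /c /t; field; rewrite subr_eq0 !gt_eqF. Qed.

(** Places count from 0, so the letter [u k] weighs [b^-(k+1)], and [c] is the total weight of all
    places. *)
Definition pcoord (i : 'I_3) (u : Ups) (n : nat) : R :=
  \sum_(k < n) (u k == i)%:R * t ^+ k.+1.

Definition bcoord (i : 'I_3) (u : Ups) : R := limn (pcoord i u).

(** Each place gives its weight to exactly one digit, which leaves a geometric sum. *)
Lemma sum_pcoord u n : \sum_(i < 3) pcoord i u n = c * (1 - t ^+ n).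
Proof.
elim: n => [|n IH].
  by rewrite expr0 subrr mulr0 big1// => i _; rewrite /pcoord big_ord0.
have -> : \sum_(i < 3) pcoord i u n.+1 = \sum_(i < 3) pcoord i u n + t ^+ n.+1.
  under eq_bigr do rewrite /pcoord big_ord_recr -/(pcoord _ _ _).
  rewrite big_split/=; congr (_ + _).
  rewrite -mulr_suml (bigD1 (u n))//= eqxx big1 ?addr0 ?mul1r// => i.
  by rewrite eq_sym => /negbTE ->.
by rewrite IH exprS !mulrBr mulr1 {2}ct; ring.
Qed.

Lemma pcoord_nd i u : nondecreasing_seq (pcoord i u).
Proof.
apply/nondecreasing_seqP => n; rewrite /pcoord big_ord_recr lerDl.
by rewrite mulr_ge0// exprn_ge0// ltW.
Qed.

Lemma pcoord_ge0 i u n : 0 <= pcoord i u n.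
Proof. by apply: sumr_ge0 => k _; rewrite mulr_ge0// exprn_ge0// ltW. Qed.

Lemma pcoord_le i u n : pcoord i u n <= c.
Proof.
apply: (@le_trans _ _ (\sum_(j < 3) pcoord j u n)).
  by rewrite (bigD1 i)//= lerDl sumr_ge0// => j _; exact: pcoord_ge0.
by rewrite sum_pcoord -[leRHS]mulr1 ler_pM2l// lerBlDr lerDl exprn_ge0// ltW.
Qed.

Lemma pcoord_cvg i u : pcoord i u n @[n --> \oo] --> bcoord i u.
Proof.
apply: nondecreasing_is_cvgn; first exact: pcoord_nd.
by exists c => _ [n _ <-]; exact: pcoord_le.
Qed.

Lemma bcoord_le i u : bcoord i u <= c.
Proof.
by apply: limr_le; [apply/cvg_ex; eexists; exact: pcoord_cvg|
  apply: nearW => n; exact: pcoord_le].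
Qed.

Lemma bcoord_ge_pcoord i u n : pcoord i u n <= bcoord i u.
Proof.
apply: nondecreasing_cvgn_le; first exact: pcoord_nd.
by apply/cvg_ex; eexists; exact: pcoord_cvg.
Qed.

Lemma bcoord_ge0 i u : 0 <= bcoord i u.
Proof. by have := bcoord_ge_pcoord i u 0; rewrite /pcoord big_ord0. Qed.

Lemma bcoordE i u : bcoord i u = t * ((u 0%N == i)%:R + bcoord i (seq_shift u)).
Proof.
have lhs : pcoord i u n.+1 @[n --> \oo] --> bcoord i u.
  by rewrite (cvg_shiftS (pcoord i u)); exact: pcoord_cvg.
apply: (cvg_unique _ lhs) => //.
have -> : (fun n => pcoord i u n.+1) =
    (fun n => t * ((u 0%N == i)%:R + pcoord i (seq_shift u) n)).
  apply/funext => n; rewrite /pcoord big_ord_recl mulrDr expr1 mulrC mulr_sumr.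
  by congr (_ + _); apply: eq_bigr => k _; rewrite [RHS]mulrCA -exprS.
apply: cvgMl_tmp.
by apply: cvgD; [exact: cvg_cst|exact: pcoord_cvg].
Qed.

Lemma sum_bcoord u : bcoord i0 u + bcoord i1 u + bcoord i2 u = c.
Proof.
have lhs : (pcoord i0 u n + pcoord i1 u n + pcoord i2 u n) @[n --> \oo] -->
    bcoord i0 u + bcoord i1 u + bcoord i2 u.
  by apply: cvgD; [apply: cvgD|]; exact: pcoord_cvg.
apply: (cvg_unique _ lhs) => //.
have -> : (fun n => pcoord i0 u n + pcoord i1 u n + pcoord i2 u n) =
    (fun n => c * (1 - t ^+ n)).
  apply/funext => n; rewrite -(sum_pcoord u) !big_ord_recl big_ord0 addr0 -addrA.
  by congr (pcoord _ _ _ + (pcoord _ _ _ + pcoord _ _ _)); exact: val_inj.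
suff : c * (1 - t ^+ n) @[n --> \oo] --> c * (1 - 0) by rewrite subr0 mulr1.
apply: cvgMl_tmp.
apply: cvgB; [exact: cvg_cst|apply: cvg_expr].
by rewrite ger0_norm// ltW.
Qed.

Lemma bcoordDn i u n : bcoord i u = pcoord i u n + t ^+ n * bcoord i (iter n seq_shift u).
Proof.
elim: n => [|n IH]; first by rewrite /pcoord big_ord0 add0r mul1r.
rewrite IH {1}bcoordE iter_shift addn0 /pcoord big_ord_recr /= -addrA; congr (_ + _).
by rewrite exprSr; ring.
Qed.

(** The recursion contracts by [t]: after [n] steps two solutions with values in [[0, c]] differ at
    the start by at most [c t^n]. *)
Lemma bcoord_unique i u (x : nat -> R) :
  (forall n, 0 <= x n <= c) -> (forall n, x n = t * ((u n == i)%:R + x n.+1)) ->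
  bcoord i u = x 0%N.
Proof.
move=> xc xE; apply/eqP; rewrite -subr_eq0 -normr_le0.
have xD n : x 0%N = pcoord i u n + t ^+ n * x n.
  elim: n => [|n IH]; first by rewrite /pcoord big_ord0 add0r mul1r.
  rewrite IH {1}xE /pcoord big_ord_recr /= -addrA; congr (_ + _).
  by rewrite exprSr; ring.
have h : geometric c t @ \oo --> 0 by apply: cvg_geometric; rewrite ger0_norm// ltW.
rewrite -(cvg_lim _ h)//; apply: limr_ge; first by apply/cvg_ex; eexists; exact: h.
apply: nearW => n; rewrite (bcoordDn i u n) (xD n) /geometric /=.
rewrite opprD addrACA subrr add0r -mulrBr normrM ger0_norm ?exprn_ge0 ?(ltW t0)//.
rewrite mulrC ler_pM2r ?exprn_gt0//.
have := bcoord_ge0 i (iter n seq_shift u); have := bcoord_le i (iter n seq_shift u).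
by have := xc n; rewrite ler_norml; lra.
Qed.

Lemma measurable_bcoord i : measurable_fun setT (bcoord i).
Proof.
apply: (measurable_fun_cvg (h := fun n u => pcoord i u n)).
  move=> n; apply: measurable_sum => k; apply: measurable_funM => //.
  rewrite (_ : (fun u : Ups => _) = \1_[set u : Ups | u k = i]).
    by apply: measurable_indic; apply: measurable_coord; exact: countableP.
  apply/funext => u; rewrite indicE; congr (nat_of_bool _)%:R.
  by apply/eqP/idP => [uk|/set_mem//]; exact: mem_set.
by move=> u _; exact: pcoord_cvg.
Qed.

End expansion.

Lemma ord3P (i : 'I_3) : [\/ i = i0, i = i1 | i = i2].
Proof.
by case: i => -[|[|[|//]]] ?; [apply: Or31|apply: Or32|apply: Or33]; exact: val_inj.
Qed.

(** * The map K_beta and its itineraries *)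

Section dynamics.
Variables (R : realType) (b : R).
Hypothesis b1 : 1 < b.
(* Equivalently b <= beta_*. *)
Hypothesis bs : b ^+ 2 * (b - 1) <= 1.
Let t := b^-1.
Let c := (b - 1)^-1.

Let b0 : 0 < b. Proof. exact: lt_trans b1. Qed.
Let t0 : 0 < t. Proof. by rewrite invr_gt0. Qed.
Let bt : b * t = 1. Proof. by rewrite mulfV// gt_eqF. Qed.
Let ct : b * c = c + 1.
Proof. by rewrite /c; field; rewrite subr_eq0 gt_eqF. Qed.
Let sE : (b * (b - 1))^-1 = c - t.
Proof. by rewrite /c /t; field; rewrite subr_eq0 !gt_eqF. Qed.
(** Three weights of sum [c] cannot all lie below [t]. The bound on [b] forces [b <= 3/2], hence
    [c >= 2], and the claim is [3 <= c + 1] divided by [b]. *)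
Let c3t : 3%:R * t <= c.
Proof.
have b32 : b <= 3 / 2.
  rewrite leNgt; apply/negP => h; have b2 : 9 / 4 < b ^+ 2 by nra.
  have : (9 / 4) * (1 / 2) < b ^+ 2 * (b - 1) by apply: ltr_pM => //; lra.
  by move: bs; lra.
have c2 : 2 <= c by rewrite /c -[leLHS]invrK lef_pV2 ?posrE ?invr_gt0 ?subr_gt0//; lra.
have : b * (3 * t) <= b * c by rewrite ct mulrCA bt; lra.
by rewrite ler_pM2l.
Qed.

(* Digit i may be subtracted without leaving Sb; c - t is 1 / (b (b - 1)). *)
Definition admissible (i : 'I_3) (z : R * R) : bool :=
  [|| (i == i0) && (z.1 + z.2 <= c - t),
      (i == i1) && (t <= z.1) | (i == i2) && (t <= z.2)].

(* In a two-way switch region, the value of omega_1 that selects the digit i. *)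
Definition switch_bit (z : R * R) (i : 'I_3) : bool :=
  if z \in C01 b then i == i1 else i == i2.

(** * The regions as patterns of admissible digits *)

Section regions.
Variable z : R * R.
Hypothesis zS : Sb b z.
(** [p0], [p1], [p2] express admissibility of the digits 0, 1, 2. On [E_i] only [i] is admissible,
    on [C_ij] exactly [i] and [j], on [C012] all three; case analysis over the regions becomes a
    truth table. *)
Let p0 := z.1 + z.2 <= c - t.
Let p1 := t <= z.1.
Let p2 := t <= z.2.

Lemma some_admissible : [|| p0, p1 | p2].
Proof.
case: zS => z1 [z2 zc]; rewrite /p0 /p1 /p2.
have [//|h1] := leP (z.1 + z.2) (c - t); have [//|h2] := leP t z.1.
by have [//|h3] := leP t z.2; move: c3t t0; lra.
Qed.

Lemma inE0 : (z \in E0 b) = ~~ p1 && ~~ p2.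
Proof.
case: zS => z1 [z2 zc]; rewrite /p1 /p2 -!ltNge.
apply/idP/andP => [/set_mem[/andP[_ ?] /andP[_ ?]]//|[? ?]].
by apply/mem_set; split; apply/andP.
Qed.

Lemma inE1 : (z \in E1 b) = ~~ p0 && ~~ p2.
Proof.
case: zS => z1 [z2 zc]; rewrite /p0 /p2 -!ltNge.
apply/idP/andP => [/set_mem[/andP[_ ?] /andP[+ _]]|[? ?]]; rewrite ?sE//.
by apply/mem_set; split; rewrite ?sE; apply/andP.
Qed.

Lemma inE2 : (z \in E2 b) = ~~ p0 && ~~ p1.
Proof.
case: zS => z1 [z2 zc]; rewrite /p0 /p1 -!ltNge.
apply/idP/andP => [/set_mem[/andP[_ ?] /andP[+ _]]|[? ?]]; rewrite ?sE//.
by apply/mem_set; split; rewrite ?sE; apply/andP.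
Qed.

Lemma inC01 : (z \in C01 b) = [&& p0, p1 & ~~ p2].
Proof.
case: zS => z1 [z2 zc]; rewrite /p0 /p1 /p2 -!ltNge.
apply/idP/and3P => [/set_mem[? [/andP[_ ?]]]|[? ? ?]]; rewrite ?sE//.
by apply/mem_set; split => //; split; rewrite ?sE//; apply/andP.
Qed.

Lemma inC02 : (z \in C02 b) = [&& p0, ~~ p1 & p2].
Proof.
case: zS => z1 [z2 zc]; rewrite /p0 /p1 /p2 -!ltNge.
apply/idP/and3P => [/set_mem[/andP[_ ?] []]|[? ? ?]]; rewrite ?sE//.
by apply/mem_set; split; rewrite ?sE//; apply/andP.
Qed.

Lemma inC12 : (z \in C12 b) = [&& ~~ p0, p1 & p2].
Proof.
case: zS => z1 [z2 zc]; rewrite /p0 /p1 /p2 -!ltNge.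
apply/idP/and3P => [/set_mem[? [? /andP[]]]|[? ? ?]]; rewrite ?sE//.
by apply/mem_set; split => //; split; rewrite ?sE//; apply/andP.
Qed.

Lemma inC012 : (z \in C012 b) = [&& p0, p1 & p2].
Proof.
rewrite /p0 /p1 /p2.
apply/idP/and3P => [/set_mem[? []]|[? ? ?]]; rewrite ?sE//.
by apply/mem_set; split => //; split; rewrite ?sE.
Qed.

Lemma inCs : (z \in Cs b) =
  [|| [&& p0, p1 & ~~ p2], [&& ~~ p0, p1 & p2] | [&& p0, ~~ p1 & p2]].
Proof. by rewrite !in_setU inC01 inC12 inC02 orbA. Qed.

End regions.

(** In the weights [c - z.1 - z.2], [z.1], [z.2], the map [aff] multiplies by [b] and takes 1 from
    the weight of [i]. The sum returns to [c] since [b c = c + 1], and admissibility keeps that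
    weight nonnegative. *)
Lemma Sb_aff z i : Sb b z -> admissible i z -> Sb b (aff b i z).
Proof.
case: z => z1 z2 [/= z10 [z20 zc]].
have h : b * z1 + b * z2 <= c + 1 by rewrite -ct -mulrDr ler_pM2l.
have bz1 := mulr_ge0 (ltW b0) z10; have bz2 := mulr_ge0 (ltW b0) z20.
have b_t x : (t <= x) = (1 <= b * x) by rewrite -(ler_pM2l b0 t) bt.
have b_s : (z1 + z2 <= c - t) = (b * z1 + b * z2 <= c).
  by rewrite -(ler_pM2l b0) mulrBr bt ct addrK mulrDr.
rewrite /admissible b_s !b_t /=.
by case: (ord3P i) => -> /=; rewrite ?orbF ?andbT => hi;
  split => /=; try split; rewrite -/c /=; lra.
Qed.

(** A uniform description of the step without the list of regions; the last two clauses recover the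
    consumed coin from the digit. *)
Lemma KstepP (x : X R) : Xb b x ->
  [/\ admissible (Kstep b x).1 x.2,
      Kb b x = (if x.2 \in Cs b then seq_shift x.1.1 else x.1.1,
                if x.2 \in C012 b then seq_shift x.1.2 else x.1.2,
                aff b (Kstep b x).1 x.2),
      x.2 \in Cs b -> x.1.1 0%N = switch_bit x.2 (Kstep b x).1 &
      x.2 \in C012 b -> x.1.2 0%N = (Kstep b x).1].
Proof.
case: x => -[w u] z; rewrite /Xb /= => zS.
have := some_admissible zS.
rewrite /Kb /Kstep /switch_bit /admissible
  inE0// inE1// inE2// inC01// inC12// inC02// inC012// inCs//=.
by case: (_ <= _); case: (_ <= _); case: (_ <= _);
  case: (w 0%N); case: (ord3P (u 0%N)) => ->.
Qed.

(** A converse to [KstepP]: an admissible digit that agrees with the coin in force is the one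
    subtracted. *)
Lemma Kstep_digit (x : X R) (i : 'I_3) : Xb b x -> admissible i x.2 ->
  (x.2 \in Cs b -> x.1.1 0%N = switch_bit x.2 i) ->
  (x.2 \in C012 b -> x.1.2 0%N = i) -> (Kstep b x).1 = i.
Proof.
case: x => -[w u] z; rewrite /Xb /= => zS.
have := some_admissible zS.
rewrite /Kstep /switch_bit /admissible
  inE0// inE1// inE2// inC01// inC12// inC02// inC012// inCs//=.
case: (_ <= _); case: (_ <= _); case: (_ <= _);
  case: (ord3P i) => -> //= _ _ hw hu;
  by [rewrite hw | rewrite hu].
Qed.

Lemma Xb_Kb (x : X R) : Xb b x -> Xb b (Kb b x).
Proof. by move=> xS; have [ai -> _ _] := KstepP xS; exact: Sb_aff. Qed.

(** * Expansions and the decoding of digit sequences *)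

Definition expansion (u : Ups) : R * R := (bcoord b i1 u, bcoord b i2 u).

Lemma expansion_Sb u : Sb b (expansion u).
Proof.
split; first exact: bcoord_ge0.
split; first exact: bcoord_ge0.
have := sum_bcoord b1 u; have := bcoord_ge0 b1 i0 u; rewrite /expansion /=; lra.
Qed.

(** The weights sum to [c], so the condition on [z.1 + z.2] for digit 0 is the same threshold on its
    weight. *)
Lemma expansion_lb i u : admissible i (expansion u) = (t <= bcoord b i u).
Proof.
have := sum_bcoord b1 u; rewrite -/c /admissible /expansion => cE.
case: (ord3P i) => -> /=; rewrite ?andbF ?orbF//=.
by apply/idP/idP; lra.
Qed.

(** The first letter alone contributes [t] to the weight of its digit. *)
Lemma admissible_expansion u : admissible (u 0%N) (expansion u).
Proof.
rewrite expansion_lb bcoordE// -/t eqxx -[leLHS]mulr1 ler_pM2l// lerDl.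
exact: bcoord_ge0.
Qed.

Lemma aff_expansion u : aff b (u 0%N) (expansion u) = expansion (seq_shift u).
Proof.
rewrite /aff /expansion /= !(bcoordE b1 _ u) -/t !mulrA bt !mul1r /q.
case: (ord3P (u 0%N)) => -> /=; congr (_, _); lra.
Qed.

Definition decode_bits (u : Ups) : Omega :=
  recorded seq_shift (fun v => expansion v \in Cs b)
    (fun v => switch_bit (expansion v) (v 0%N)) u.

(** Records are boolean, so the digit at a visit is found by testing equality with 1 and with 2;
    [i0] is also the default when there are too few visits. *)
Definition decode_digits (u : Ups) : Ups := fun k =>
  let rec i := recorded seq_shift (fun v => expansion v \in C012 b)
    (fun v : Ups => v 0%N == i) u k in
  if rec i1 then i1 else if rec i2 then i2 else i0.

Definition decoding (u : Ups) : X R := (decode_bits u, decode_digits u, expansion u).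

Lemma Xb_decoding u : Xb b (decoding u). Proof. exact: expansion_Sb. Qed.

Lemma Kstep_decoding u : (Kstep b (decoding u)).1 = u 0%N.
Proof.
apply: Kstep_digit; rewrite /=; first exact: Xb_decoding.
- exact: admissible_expansion.
- by move=> uC; rewrite /decode_bits recorded0.
- move=> uC; rewrite /decode_digits !recorded0//.
  by case: (ord3P (u 0%N)) => ->.
Qed.

(** The records lose their first entry exactly at the visits where [Kb] shifts the corresponding
    sequence. *)
Lemma Kb_decoding u : Kb b (decoding u) = decoding (seq_shift u).
Proof.
have [_ -> _ _] := KstepP (Xb_decoding u); rewrite Kstep_decoding /decoding /=.
congr (_, _, _); last exact: aff_expansion.
- case: ifP => uC; apply/funext => k; rewrite /decode_bits.
    by rewrite /seq_shift recordedS.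
  by rewrite recorded_skip ?uC.
- case: ifP => uC; apply/funext => k; rewrite /decode_digits.
    by rewrite /seq_shift !recordedS.
  by rewrite !recorded_skip ?uC.
Qed.

Lemma iter_Kb_decoding n u : iter n (Kb b) (decoding u) = decoding (iter n seq_shift u).
Proof. by elim: n u => // n IH u; rewrite !iterSr Kb_decoding IH. Qed.

Lemma phi_decoding u : phi b (decoding u) = u.
Proof.
by apply/funext => n; rewrite /phi iter_Kb_decoding Kstep_decoding iter_shift addn0.
Qed.

Lemma iter_Xb n (x : X R) : Xb b x -> Xb b (iter n (Kb b) x).
Proof. by move=> xS; elim: n => // n IH; exact: Xb_Kb. Qed.

Lemma phi_shift n (x : X R) : phi b (iter n (Kb b) x) = iter n seq_shift (phi b x).
Proof.
by apply/funext => k; rewrite iter_shift /phi -iterD addnC.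
Qed.

(** The orbit stays in [Sb], and its coordinates satisfy the weight recursion driven by the digits
    of [x]; [bcoord_unique] identifies them. *)
Lemma expansion_phi (x : X R) : Xb b x -> expansion (phi b x) = x.2.
Proof.
move=> xS; pose z n := (iter n (Kb b) x).2.
have zc n : 0 <= (z n).1 <= c /\ 0 <= (z n).2 <= c.
  by have [? [? ?]] := iter_Xb n xS; split; apply/andP; split => //; rewrite /c; lra.
have zE n : z n.+1 = aff b (phi b x n) (z n).
  by rewrite /z iterS; have [_ -> _ _] := KstepP (iter_Xb n xS).
have tb y w : w = b * y -> y = t * w by move=> ->; rewrite mulrA mulVf ?mul1r// gt_eqF.
rewrite /expansion [RHS]surjective_pairing; congr (_, _).
  apply: (bcoord_unique b1 (x := fun n => (z n).1)) => n; first by have [] := zc n.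
  apply: tb; rewrite zE /aff /q /=.
  by case: (ord3P (phi b x n)) => -> /=; lra.
apply: (bcoord_unique b1 (x := fun n => (z n).2)) => n; first by have [] := zc n.
apply: tb; rewrite zE /aff /q /=.
by case: (ord3P (phi b x n)) => -> /=; lra.
Qed.

(** The expansions of the shifted digit sequence are the points of the orbit, so visits can be
    counted on either side. A coin sequence has been shifted once per past visit, hence its head at
    a visit is the entry numbered by the count. *)
Lemma decoding_phi (x : X R) : Zb b x -> decoding (phi b x) = x.
Proof.
move=> [xS [ioC ioC012]].
have pt n : expansion (iter n seq_shift (phi b x)) = (iter n (Kb b) x).2.
  by rewrite -phi_shift expansion_phi//; exact: iter_Xb.
have dig n : iter n seq_shift (phi b x) 0%N = phi b x n by rewrite iter_shift addn0.
have bits n : (iter n (Kb b) x).1.1 =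
    iter (visits seq_shift (fun v => expansion v \in Cs b) (phi b x) n) seq_shift x.1.1.
  elim: n => [|n IH]; first by rewrite /visits big_ord0.
  rewrite visitsSr iterS; have [_ -> _ _] := KstepP (iter_Xb n xS).
  by rewrite /= IH pt; case: ifP; rewrite ?addn0 ?addn1.
have digits n : (iter n (Kb b) x).1.2 =
    iter (visits seq_shift (fun v => expansion v \in C012 b) (phi b x) n) seq_shift x.1.2.
  elim: n => [|n IH]; first by rewrite /visits big_ord0.
  rewrite visitsSr iterS; have [_ -> _ _] := KstepP (iter_Xb n xS).
  by rewrite /= IH pt; case: ifP; rewrite ?addn0 ?addn1.
rewrite [RHS]surjective_pairing [X in (X, _)]surjective_pairing /decoding.
congr (_, _, _); last exact: expansion_phi.
- apply/funext; apply: recorded_id => [N|j].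
    by have [n Nn Cn] := ioC N; exists n => //; rewrite pt; exact: mem_set.
  rewrite pt dig => jC; have [_ _ /(_ jC) wj _] := KstepP (iter_Xb j xS).
  by rewrite -wj bits iter_shift addn0.
- have rec i k : recorded seq_shift (fun v => expansion v \in C012 b)
      (fun v : Ups => v 0%N == i) (phi b x) k = (x.1.2 k == i).
    apply: (recorded_id (w := fun k => x.1.2 k == i)) => [N|j].
      by have [n Nn Cn] := ioC012 N; exists n => //; rewrite pt; exact: mem_set.
    rewrite pt dig => jC; have [_ _ _ /(_ jC) wj] := KstepP (iter_Xb j xS).
    by rewrite /phi -wj digits iter_shift addn0.
  apply/funext => k; rewrite /decode_digits !rec.
  by case: (ord3P (x.1.2 k)) => ->.
Qed.

End dynamics.

(** * Measurability *)

Section measurable_sets.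
Context d (T : measurableType d) (R : realType).

Lemma measurable_conj (P Q : T -> Prop) :
  measurable [set x | P x] -> measurable [set x | Q x] -> measurable [set x | P x /\ Q x].
Proof. exact: measurableI. Qed.

Lemma measurable_andb (P Q : T -> bool) :
  measurable [set x | P x] -> measurable [set x | Q x] -> measurable [set x | P x && Q x].
Proof.
move=> mP mQ; rewrite (_ : mkset _ = [set x | P x] `&` [set x | Q x]); first exact: measurableI.
by apply/seteqP; split => x /andP.
Qed.

Lemma measurable_le (f g : T -> R) : measurable_fun setT f -> measurable_fun setT g ->
  measurable [set x | f x <= g x].
Proof.
move=> mf mg; have := measurable_fun_ler mf mg => /(_ measurableT [set true] I).
by rewrite setTI.
Qed.

Lemma measurable_lt (f g : T -> R) : measurable_fun setT f -> measurable_fun setT g ->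
  measurable [set x | f x < g x].
Proof.
move=> mf mg; have := measurable_fun_ltr mf mg => /(_ measurableT [set true] I).
by rewrite setTI.
Qed.

Lemma measurable_fun_pred (P : pred T) :
  measurable [set x | P x] -> measurable_fun setT P.
Proof. by move=> mP; apply: (measurable_fun_bool true); rewrite setTI. Qed.

Lemma measurable_bool_eq (P : T -> bool) c :
  measurable_fun setT P -> measurable [set x | P x = c].
Proof. by move=> mP; rewrite -[mkset _]setTI; exact: (mP measurableT [set c] I). Qed.

End measurable_sets.

Section measurable_dynamics.
Variables (R : realType) (b : R).

Let mX := @measurable_fst _ _ R R.
Let mY := @measurable_snd _ _ R R.
Let mXY : measurable_fun setT (fun z : R * R => z.1 + z.2).
Proof. exact: measurable_funD. Qed.

Local Ltac region := rewrite /E0 /E1 /E2 /C01 /C12 /C02 /C012 /Sb;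
  repeat first [apply: measurable_conj | apply: measurable_andb];
  (apply: measurable_le || apply: measurable_lt) => //.

Lemma measurable_Sb : measurable (Sb b). Proof. region. Qed.
Lemma measurable_E0 : measurable (E0 b). Proof. region. Qed.
Lemma measurable_E1 : measurable (E1 b). Proof. region. Qed.
Lemma measurable_E2 : measurable (E2 b). Proof. region. Qed.
Lemma measurable_C01 : measurable (C01 b). Proof. region. Qed.
Lemma measurable_C12 : measurable (C12 b). Proof. region. Qed.
Lemma measurable_C02 : measurable (C02 b). Proof. region. Qed.
Lemma measurable_C012 : measurable (C012 b). Proof. region. Qed.
Lemma measurable_Cs : measurable (Cs b).
Proof.
by apply: measurableU; [apply: measurableU; [exact: measurable_C01|exact: measurable_C12]|
  exact: measurable_C02].
Qed.

Let mW : measurable_fun setT (fun x : X R => x.1.1).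
Proof. exact: measurableT_comp measurable_fst measurable_fst. Qed.
Let mU : measurable_fun setT (fun x : X R => x.1.2).
Proof. exact: measurableT_comp measurable_snd measurable_fst. Qed.
Let mZ : measurable_fun setT (fun x : X R => x.2).
Proof. exact: measurable_snd. Qed.

Lemma measurable_in_snd (A : set (R * R)) : measurable A ->
  measurable_fun setT (fun x : X R => x.2 \in A).
Proof.
move=> mA; apply: measurable_fun_pred.
rewrite (_ : mkset _ = setT `&` (fun x : X R => x.2) @^-1` A); first exact: mZ.
by rewrite setTI; apply/seteqP; split => x /=; [move/set_mem|move=> ?; apply/mem_set].
Qed.

Lemma measurable_aff i : measurable_fun setT (aff b i).
Proof.
by apply: measurable_fun_pair; apply: measurable_funB => //; apply: measurable_funM.
Qed.

(** A general [F] covers both uses: [snd] for [Kb], and the test of the digit against a fixed [i]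
    for [phi]. *)
Lemma measurable_Kstep d (T : measurableType d) (F : 'I_3 * X R -> T) :
  (forall i (g : X R -> X R), measurable_fun setT g ->
    measurable_fun setT (fun x => F (i, g x))) ->
  measurable_fun setT (fun x => F (Kstep b x)).
Proof.
move=> mF.
(* Branching on the coins makes the digit constant in each branch, where measurability of a single
   [aff b i] suffices. *)
rewrite (_ : (fun x => _) = (fun x =>
  let a w u i := F (i, (w, u, aff b i x.2)) in
  let w := x.1.1 in let u := x.1.2 in
  if x.2 \in E0 b then a w u i0
  else if x.2 \in E1 b then a w u i1
  else if x.2 \in E2 b then a w u i2
  else if x.2 \in C01 b then
    if w 0%N then a (seq_shift w) u i1 else a (seq_shift w) u i0
  else if x.2 \in C12 b then
    if w 0%N then a (seq_shift w) u i2 else a (seq_shift w) u i1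
  else if x.2 \in C02 b then
    if w 0%N then a (seq_shift w) u i2 else a (seq_shift w) u i0
  else if x.2 \in C012 b then
    if u 0%N == i0 then a w (seq_shift u) i0 else
    if u 0%N == i1 then a w (seq_shift u) i1 else a w (seq_shift u) i2
  else F (i0, x))); last first.
  apply/funext => -[[w u] z] /=.
  do 7 (case: ifP => _; first by [|case: (w 0%N)|case: (ord3P (u 0%N)) => ->]).
  by [].
have ma (g : X R -> Omega) (h : X R -> Ups) i : measurable_fun setT g -> measurable_fun setT h ->
    measurable_fun setT (fun x : X R => F (i, (g x, h x, aff b i x.2))).
  move=> mg mh; apply: mF; apply: measurable_fun_pair; first exact: measurable_fun_pair.
  exact: measurableT_comp (measurable_aff i) mZ.
have mw0 : measurable_fun setT (fun x : X R => x.1.1 0%N).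
  apply: measurable_fun_pred.
  rewrite (_ : mkset _ = setT `&` (fun x : X R => x.1.1) @^-1` [set w : Omega | w 0%N = true]).
    by apply: mW => //; apply: measurable_coord; exact: countableP.
  by rewrite setTI; apply/seteqP; split.
have mu0 i : measurable_fun setT (fun x : X R => x.1.2 0%N == i).
  apply: measurable_fun_pred.
  rewrite (_ : mkset _ = setT `&` (fun x : X R => x.1.2) @^-1` [set u : Ups | u 0%N = i]).
    by apply: mU => //; apply: measurable_coord; exact: countableP.
  by rewrite setTI; apply/seteqP; split => x /eqP.
have msw : measurable_fun setT (fun x : X R => seq_shift x.1.1 : Omega).
  by apply: measurableT_comp mW; apply: measurable_shift; exact: countableP.
have msu : measurable_fun setT (fun x : X R => seq_shift x.1.2 : Ups).
  by apply: measurableT_comp mU; apply: measurable_shift; exact: countableP.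
have mE0 := measurable_in_snd measurable_E0; have mE1 := measurable_in_snd measurable_E1.
have mE2 := measurable_in_snd measurable_E2; have mC01 := measurable_in_snd measurable_C01.
have mC12 := measurable_in_snd measurable_C12; have mC02 := measurable_in_snd measurable_C02.
have mC012 := measurable_in_snd measurable_C012.
repeat apply: measurable_fun_ifT => //; try exact: ma.
exact: mF.
Qed.

Lemma measurable_Kb : measurable_fun setT (Kb b).
Proof. by apply: (measurable_Kstep (F := snd)) => i g. Qed.

Lemma measurable_phi : measurable_fun setT (phi b).
Proof.
apply: measurable_fun_seq => n i.
rewrite (_ : mkset _ = setT `&` iter n (Kb b) @^-1`
    (setT `&` (fun x => (Kstep b x).1 == i) @^-1` [set true])).
  apply: (measurable_iter_fun n measurable_Kb) => //.
  by apply: (measurable_Kstep (F := fun p => p.1 == i)) => // j g _; exact: measurable_cst.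
by rewrite !setTI; apply/seteqP; split => x /eqP.
Qed.

Lemma measurable_Zb : measurable (Zb b).
Proof.
have mio A : measurable A ->
    measurable [set x : X R | forall N, exists2 n, (N <= n)%N & A (iter n (Kb b) x).2].
  move=> mA; rewrite (_ : mkset _ = \bigcap_N \bigcup_(n in [set n | (N <= n)%N])
      (setT `&` (snd \o iter n (Kb b)) @^-1` A)).
    apply: bigcap_measurableType => N _; apply: bigcup_measurable => n _.
    by apply: measurableT_comp => //; exact: (measurable_iter_fun n measurable_Kb).
  apply/seteqP; split => [x ioA N _|x ioA N].
    by have [n Nn An] := ioA N; exists n.
  by have [n Nn [_ An]] := ioA N I; exists n.
apply: measurable_conj; last by apply: measurable_conj; apply: mio;
  [exact: measurable_Cs|exact: measurable_C012].
rewrite -[mkset _]setTI; apply: mZ => //; exact: measurable_Sb.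
Qed.

Hypothesis b1 : 1 < b.

Lemma measurable_expansion : measurable_fun setT (expansion b).
Proof. by apply: measurable_fun_pair; exact: measurable_bcoord. Qed.

Lemma measurable_decoding : measurable_fun setT (decoding b).
Proof.
have mp A : measurable A -> measurable [set u : Ups | expansion b u \in A].
  move=> mA; rewrite (_ : mkset _ = setT `&` expansion b @^-1` A).
    exact: measurable_expansion.
  by rewrite setTI; apply/seteqP; split => u /=; [move/set_mem|move=> ?; apply/mem_set].
have mu0 i : measurable [set u : Ups | u 0%N == i].
  rewrite (_ : mkset _ = [set u : Ups | u 0%N = i]); last by apply/seteqP; split => u /eqP.
  by apply: measurable_coord; exact: countableP.
have ms : measurable_fun setT (seq_shift : Ups -> Ups).
  by apply: measurable_shift; exact: countableP.
apply: measurable_fun_pair measurable_expansion.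
apply: measurable_fun_pair; apply: measurable_fun_seq => k s.
- apply/measurable_bool_eq/measurable_fun_pred/measurable_recorded => //.
    apply: mp; exact: measurable_Cs.
  have /measurable_fun_pred mC := mp _ measurable_C01.
  apply: measurable_bool_eq; apply: measurable_fun_ifT => //;
    exact: measurable_fun_pred.
- rewrite (_ : mkset _ = [set u | (decode_digits b u k == s) = true]); last first.
    by apply/seteqP; split => u /eqP.
  apply: measurable_bool_eq.
  (* Comparing with [s] inside the branches leaves conditionals between boolean constants. *)
  rewrite (_ : (fun u => _) = (fun u : Ups =>
    let rec i := recorded seq_shift (fun v => expansion b v \in C012 b)
      (fun v : Ups => v 0%N == i) u k in
    if rec i1 then i1 == s else if rec i2 then i2 == s else i0 == s)); last first.
    by apply/funext => u; rewrite /decode_digits; case: ifP => // _; case: ifP.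
  have mr i : measurable_fun setT (fun u : Ups =>
      recorded seq_shift (fun v => expansion b v \in C012 b) (fun v : Ups => v 0%N == i) u k).
    by apply/measurable_fun_pred/measurable_recorded => //; apply: mp; exact: measurable_C012.
  by apply: measurable_fun_ifT => //; apply: measurable_fun_ifT.
Qed.

End measurable_dynamics.

(** * Recurrence to C and C012 *)

Section recurrence.
Variables (R : realType) (b : R).
Hypotheses (b1 : 1 < b) (bs : b ^+ 2 * (b - 1) <= 1).
Let t := b^-1.
Let c := (b - 1)^-1.

Let b0 : 0 < b. Proof. exact: lt_trans b1. Qed.
Let t0 : 0 < t. Proof. by rewrite invr_gt0. Qed.
Let t1 : t < 1. Proof. by rewrite invf_lt1. Qed.
Let bt : b * t = 1. Proof. by rewrite mulfV// gt_eqF. Qed.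

(** Dividing [b^2 (b - 1) <= 1] by [b^3] gives [1 <= t + t^3], with equality at [beta_*]. *)
Let t_gap k : t ^+ k <= t ^+ k.+1 + t ^+ k.+3.
Proof.
have : t ^+ 3 * (b ^+ 2 * (b - 1)) <= t ^+ 3 by rewrite ler_piMr// exprn_ge0// ltW.
have -> : t ^+ 3 * (b ^+ 2 * (b - 1)) = 1 - t.
  have -> : t ^+ 3 * (b ^+ 2 * (b - 1)) = (b * t) ^+ 2 * (b * t - t) by ring.
  by rewrite bt expr1n mul1r.
rewrite lerBlDr => h; have -> : t ^+ k.+1 + t ^+ k.+3 = t ^+ k * (t ^+ 3 + t).
  by rewrite mulrDr -exprD -exprSr addn3 addrC.
by rewrite ler_peMr// exprn_ge0// ltW.
Qed.

Lemma pcoord_cyl i n (w : nat -> 'I_3) u : cyl n w u -> pcoord b i u n = pcoord b i w n.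
Proof. by move=> uw; apply: eq_bigr => k _; rewrite uw. Qed.

(* At b = beta_* the three digits receive the weights t, t^2 + t^4 and
   t^3 + t^5 + t^6 + t^7 + t^8, all equal to t. *)
Definition word012 : nat -> 'I_3 := nth i0 [:: i0; i1; i2; i1; i2; i2; i2; i2].

Lemma word012_C012 u : cyl 8 word012 u -> C012 b (expansion b u).
Proof.
move=> uw; apply/set_mem; rewrite inC012//.
(* Digit 1 needs [t <= t^2 + t^4]. For digit 2, replace [t^2] by [t^3 + t^5], [t^4] by [t^5 + t^7],
   then one of the two [t^5] by [t^6 + t^8]. *)
have h1 := t_gap 1; have h2 := t_gap 2; have h4 := t_gap 4; have h5 := t_gap 5.
have t_pos k : 0 <= t ^+ k by rewrite exprn_ge0// ltW.
have lb i : admissible b i (expansion b u).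
  rewrite expansion_lb// -/t; apply: le_trans (bcoord_ge_pcoord b1 i u 8).
  rewrite (pcoord_cyl i uw) /pcoord -/t !big_ord_recl big_ord0 /word012 /=.
  by case: (ord3P i) => -> /=; rewrite ?mul0r ?mul1r ?add0r ?addr0; lra.
have := lb i0; have := lb i1; have := lb i2.
by rewrite /admissible /= !orbF => -> -> ->.
Qed.

(* The 1s filling the rest of the word make the weight of digit 0 small. *)
Definition word12 (n : nat) : 'I_3 := if (n == 1%N) || (n == 3%N) then i2 else i1.

(** Digit 1 gets [t] from the first letter and digit 2 gets [t^2 + t^4 >= t], while digit 0 can
    occur only after the prefix. *)
Lemma word12_C12 : exists n, forall u, cyl n word12 u -> C12 b (expansion b u).
Proof.
have h : geometric c t @ \oo --> 0 by apply: cvg_geometric; rewrite ger0_norm// ltW.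
(* The length makes the tail [c t^(n+4)] smaller than [t]; the 4 ensures that both letters 2 belong
   to the prefix. *)
have /cvgrPdist_lt /(_ t t0) [n _ /(_ (n + 4)%N (leq_addr _ _))] := h.
rewrite /= sub0r normrN => cn; exists (n + 4)%N => u uw.
apply/set_mem; rewrite inC12//; last exact: expansion_Sb.
have := expansion_lb b1 i0 u; rewrite /admissible /= !orbF => ->.
rewrite -ltNge -/t; apply/and3P; split.
- rewrite (bcoordDn b1 i0 u (n + 4)) (pcoord_cyl _ uw) /pcoord big1 ?add0r.
    apply: le_lt_trans cn; apply: le_trans (ler_norm _).
    by rewrite mulrC ler_wpM2r ?exprn_ge0 ?(ltW t0)//; exact: bcoord_le.
  by move=> k _; rewrite /word12; case: ifP; rewrite mul0r.
- apply: le_trans (bcoord_ge_pcoord b1 i1 u 1).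
  by rewrite /pcoord big_ord_recl big_ord0 uw ?addn4// mul1r addr0.
- apply: le_trans (bcoord_ge_pcoord b1 i2 u 4).
  have uw4 : cyl 4 word12 u by move=> k k4; rewrite uw// ltn_addl.
  rewrite (pcoord_cyl _ uw4) /pcoord -/t !big_ord_recl big_ord0 /word12 /=.
  by have := t_gap 1; rewrite ?mul0r ?mul1r ?add0r ?addr0.
Qed.

End recurrence.

(** * The isomorphism given by [phi] and [decoding] *)

Theorem theorem4p6 (R : realType) (bstar b : R)
  (P : probability Ups R)
  (hP : forall (n : nat) (a : nat -> 'I_3), P (cyl n a) = ((3%:R : R) ^- n)%:E)
  (hbstar : bstar ^+ 3 - bstar ^+ 2 - 1 = 0)
  (hb : 1 < b <= bstar) :
  [/\ is_probability_on (Xb b) (nub b P),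
      measurable_fun (Xb b) (Kb b) &
      ds_isomorphic (Xb b) (nub b P) (Kb b) setT P seq_shift].
Proof.
have /andP[b1 bb] := hb.
(* The cubic says [bstar^2 (bstar - 1) = 1], and [x^2 (x - 1)] increases for [x >= 1]. *)
have bs : b ^+ 2 * (b - 1) <= 1.
  have -> : 1 = bstar ^+ 2 * (bstar - 1).
    by apply/eqP; rewrite -subr_eq0 -oppr_eq0 -hbstar; apply/eqP; ring.
  have b0 : 0 <= b by lra.
  apply: ler_pM; [exact: exprn_ge0|lra| |lra].
  by apply: lerXn2r; rewrite ?nnegrE; lra.
have mdec := measurable_decoding b1; have mZ := measurable_Zb b.
(* On [Zb] the map [phi] is inverted by [decoding], so its images are preimages; these are
   measurable when [A] is. *)
have phiE A : phi b @` (Zb b `&` A) = decoding b @^-1` (Zb b `&` A).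
  apply/seteqP; split => [_ [x [xZ xA] <-]|u uA].
    by rewrite /preimage /= decoding_phi.
  by exists (decoding b u) => //; exact: phi_decoding.
pose M := decoding b @^-1` Zb b.
have mM : measurable M by rewrite -[M]setTI; exact: mdec.
have [n word] := word12_C12 b1 bs.
(* Almost every [u] contains both words infinitely often, and each occurrence puts the orbit of
   [decoding b u] in [Cs] or in [C012]. *)
have PM : P (~` M) = 0%E.
  apply: measure_negligible; first exact: measurableC.
  apply: negligibleS (negligibleU (measure_io_cyl hP n word12) (measure_io_cyl hP 8 word012)).
  rewrite -setCI; apply: subsetC => u [io12 io012].
  split; first exact: Xb_decoding.
  split=> N; [have [k Nk uk] := io12 N|have [k Nk uk] := io012 N]; exists k => //.
    by rewrite iter_Kb_decoding//; left; right; exact: word.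
  by rewrite iter_Kb_decoding//; exact: word012_C012.
have PM1 : P M = 1%E.
  by rewrite -[M]setCK probability_setC ?PM ?sube0//; exact: measurableC.
(* Hence [nub] is the image of [P] under [decoding], restricted to [Zb], and inherits countable
   additivity. *)
pose m := [the {measure set (X R) -> \bar R} of mrestr (pushforward P (decoding b)) mZ].
have nubE : nub b P = m mdec.
  by apply/funext => A; rewrite /nub phiE setIC.
split.
- split.
  + by rewrite nubE measure0.
  + by move=> A mA; rewrite nubE; exact: measure_ge0.
  + by rewrite nubE; exact: measure_semi_sigma_additive.
  + by rewrite /nub phiE setIidl// => x [].
- by apply: measurable_funTS; exact: measurable_Kb.
- exists (Zb b), M, (phi b), (decoding b).
  (* A visit of [x] at time [k + 1 >= N + 1] is a visit of [Kb b x] at time [k >= N]. *)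
  have KZ x : Zb b x -> Zb b (Kb b x).
    move=> [xX [ioC ioC012]]; split; first exact: Xb_Kb.
    split=> N; [have [[//|k] Nk uk] := ioC N.+1|have [[//|k] Nk uk] := ioC012 N.+1];
      by exists k => //; rewrite -iterSr.
  split.
  + split=> //; first by move=> x [].
      by rewrite /nub setDE setIA setIC setIA setICl !set0I image_set0 measure0.
    by move=> _ [x xZ <-]; exact: KZ.
  + split=> //; first by rewrite setTD.
    by move=> _ [u uM <-]; rewrite /M /preimage /= -Kb_decoding//; exact: KZ.
  + split.
    * by move=> _ [x xZ <-]; rewrite /M /preimage /= decoding_phi.
    * by move=> _ [u uM <-].
    * by move=> x xZ; exact: decoding_phi.
    * by move=> u _; exact: phi_decoding.
  + split.
    * by apply: measurable_funTS; exact: measurable_phi.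
    * exact: measurable_funTS.
    * move=> B mB; rewrite /nub setIA setIid phiE; congr (P _).
      by apply/seteqP; split => u [uM]; rewrite /preimage /= phi_decoding.
  + by move=> x _; exact: (@phi_shift R b 1 x).
Qed.
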